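(* Let $X$ be a finite set and $>$ a monomial-center ordering on $\lfloor X^+\rfloor_1\cup\lfloor XX\rfloor_2$. Then the following algorithm, applied to a finite set $F=\{f_1,\dots,f_m\}\subseteq Di[X]$, terminates after finitely many steps and returns a Gröbner--Shirshov basis $S$ in $Di[X]$ for $Id(F)$. Algorithm. Initialize $S:=\{lc(f)^{-1}f\mid 0\ne f\in F\}$ and $\mathcal G:=\{s,(s,g)\mid s,g\in S\}$. For each $u\in\mathcal G$ (including items added to $\mathcal G$ later), and for each composition of $u$ (a composition of the single polynomial $u$, or of the pair $u$): let $h$ be a remainder of this composition modulo the current $S$; if $h\ne0$, replace $h$ by $lc(h)^{-1}h$, set $\mathcal G:=\mathcal G\cup\{h\}\cup\{(h,s)\mid s\in S\}\cup\{(s,h)\mid s\in S\}$, and then $S:=S\cup\{h\}$. When all items of $\mathcal G$ have been processed, return $S$.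
   Context: Fix a field $\mathbf{k}$. A commutative dialgebra is a $\mathbf{k}$-linear space with two bilinear operations $\vdash,\dashv$, each associative and commutative, satisfying $a\dashv(b\vdash c)=a\dashv(b\dashv c)$, $(a\dashv b)\vdash c=(a\vdash b)\vdash c$, $a\vdash(b\dashv c)=(a\vdash b)\dashv c$. An ideal is a subspace closed under multiplication (by $\vdash$ and by $\dashv$) with arbitrary elements; $Id(S)$ is the ideal generated by $S$. Let $X$ be a totally ordered set, $\lfloor X^+\rfloor$ the free commutative semigroup without unit on $X$ (elements $\lfloor u\rfloor$, length $|u|$), $\lfloor X^*\rfloor=\lfloor X^+\rfloor\cup\{\varepsilon\}$ the free commutative monoid. Let $\lfloor X^+\rfloor_1=\{\lfloor u\rfloor_1\mid\lfloor u\rfloor\in\lfloor X^+\rfloor\}$ and $\lfloor XX\rfloor_2=\{\lfloor v\rfloor_2\mid\lfloor v\rfloor\in\lfloor X^+\rfloor,|v|=2\}$ (formal symbols); $x\in X$ is identified with $\lfloor x\rfloor_1$. $Di[X]$ is the free commutative dialgebra generated by $X$: the $\mathbf{k}$-space with basis $\lfloor X^+\rfloor_1\cup\lfloor XX\rfloor_2$ and operations: for $x,x'\in X$, $x\dashv x'=\lfloor xx'\rfloor_1$, $x\vdash x'=\lfloor xx'\rfloor_2$; and if $|uv|>2$, $\lfloor u\rfloor_p\vdash\lfloor v\rfloor_q=\lfloor u\rfloor_p\dashv\lfloor v\rfloor_q=\lfloor uv\rfloor_1$. Ordering. A monomial ordering on $\lfloor X^+\rfloor$ is a well (total) ordering with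 $\lfloor u\rfloor>\lfloor v\rfloor\Rightarrow\lfloor uw\rfloor>\lfloor vw\rfloor$. The associated monomial-center ordering on $\lfloor X^+\rfloor_1\cup\lfloor XX\rfloor_2$ is: $\lfloor u\rfloor_m>\lfloor v\rfloor_n$ iff $(\lfloor u\rfloor,m)>(\lfloor v\rfloor,n)$ lexicographically. For nonzero $f\in Di[X]$: $supp(f)$ is the set of basis elements occurring with nonzero coefficient; $\overline f$ its largest element (leading monomial), $lc(f)$ its coefficient; $\widetilde f\in\lfloor X^+\rfloor$ is the word $\lfloor u\rfloor$ if $\overline f=\lfloor u\rfloor_m$; $r_f=f-lc(f)\overline f$. Convention: $\overline 0=\widetilde 0=0$ is smaller than everything. $f$ is monic if $lc(f)=1$; a set is monic if all its elements are. $f\ne0$ is strong if $\widetilde f>\widetilde{r_f}$. Normal polynomials. For a monic set $S$ the normal $S$-polynomials (normal $s$-polynomials, $s\in S$) $\lfloor sb\rfloor_m$ ($\lfloor b\rfloor\in\lfloor X^*\rfloor$, $m\in\{1,2\}$) are: $\lfloor sb\rfloor_m=s$ if $b=\varepsilon$ ($m$ being the index of $\overline s$); $\lfloor sb\rfloor_2=s\vdash b$ if $|\widetilde s|=1$ and $b\in X$; $\lfloor sb\rfloor_1=s\dashv\lfloor b\rfloor_1$ if $s$ is strong and $\lfloor b\rfloor\in\lfloor X^+\rfloor$. Compositions of monic $f,g\in Di[X]$: (i) if $f$ is not strong, for each $x\in X$, $f\vdash x$ and $f\dashv x$; (ii) if $f$ is strong, $|\widetilde f|>1$ and $supp(f)\cap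 X\ne\emptyset$, for each $x\in X$, $(f\vdash x)-(f\dashv x)$; (iii) if $f\neq g$, $\overline f=\overline g$: $f-g$; (iv) if $|\widetilde f|=2$, $|\widetilde g|=1$ and there is a normal $g$-polynomial $\lfloor gx\rfloor_m$, $x\in X$, with $\overline f=\overline{\lfloor gx\rfloor_m}$: $f-\lfloor gx\rfloor_m$; (v) if $f,g$ are strong, $|\widetilde f|+|\widetilde g|>3$, $\overline f\ne\overline g$: when $\widetilde f=\widetilde g$, for each $x\in X$, $\lfloor fx\rfloor_1-\lfloor gx\rfloor_1$; when $\widetilde f\neq\widetilde g$ and $lcm\{\widetilde f,\widetilde g\}=\lfloor w\rfloor=\lfloor\widetilde fa\rfloor=\lfloor\widetilde gb\rfloor$ with $\lfloor a\rfloor\in\lfloor X^*\rfloor$, $\lfloor b\rfloor\in\lfloor X^+\rfloor$, $|w|<|\widetilde f|+|\widetilde g|$: $\lfloor fa\rfloor_1-\lfloor gb\rfloor_1$. Types (i),(ii) are compositions of the single polynomial $f$; types (iii)--(v) are compositions of the pair $(f,g)$. $h\in Di[X]$ is trivial modulo $S$ if $h=\sum_i\alpha_i\lfloor s_ib_i\rfloor_{m_i}$ (finite sum, $\alpha_i\in\mathbf{k}$, normal $S$-polynomials) with $\overline{\lfloor s_ib_i\rfloor_{m_i}}\le\overline h$ whenever $\alpha_i\ne0$. A monic set $S$ is a Gröbner--Shirshov basis in $Di[X]$ if every composition of polynomials in $S$ is trivial modulo $S$; it is then called a Gröbner--Shirshov basis for $Id(S)$. Reduction. A nonzero $f$ is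 reducible by $S$ if some $\lfloor u\rfloor_m\in supp(f)$ equals $\overline{\lfloor gb\rfloor_m}$ for a normal $g$-polynomial $\lfloor gb\rfloor_m$, $g\in S$; then, with $\alpha$ the coefficient of $\lfloor u\rfloor_m$ in $f$, replacing $f$ by $f-\frac{\alpha}{lc(g)}\lfloor gb\rfloor_m$ is a one-step-reduction by $S$. A remainder of $f$ modulo $S$ is an element obtained from $f$ by finitely many one-step-reductions by $S$ that is not reducible by $S$ (0 is not reducible). *)

(* Defs.v *)
From Stdlib Require Import Relation_Operators.
From mathcomp Require Import all_boot all_algebra.
From mathcomp Require Export finmap.
From mathcomp.multinomials Require Export monalg.

Set Implicit Arguments.
Unset Strict Implicit.
Unset Printing Implicit Defensive.

Import GRing.Theory.

Local Open Scope fset_scope.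
Local Open Scope ring_scope.

Section FreeDialgebra.
Variables (k : fieldType) (X : choiceType).

(* The free commutative semigroup on X, as a subset of the free commutative
   monoid {cmonom X}. *)
Definition nonempty_word : {pred {cmonom X}} := [pred u | 0 < mdeg u]%N.

Record monomial_order (lt : rel {cmonom X}) : Prop := MonomialOrder {
  mo_irr : {in nonempty_word, irreflexive lt};
  mo_trans : {in nonempty_word & &, transitive lt};
  mo_total : {in nonempty_word &, forall u v, u != v -> lt u v || lt v u};
  mo_wf : well_founded
    (fun u v => [&& u \in nonempty_word, v \in nonempty_word & lt u v]);
  mo_mul : {in nonempty_word & &, forall u v w,
    lt v u -> lt (mmul v w) (mmul u w)}
}.

(* The pair (u, m) stands for the basis symbol [u]_m. *)
Definition is_basis (p : {cmonom X} * nat) : bool :=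
  (p.1 \in nonempty_word) && ((p.2 == 1) || (p.2 == 2) && (mdeg p.1 == 2))%N.

Definition basis := {p : {cmonom X} * nat | is_basis p}.

Definition bword (a : basis) : {cmonom X} := (val a).1.
Definition bidx (a : basis) : nat := (val a).2.

Definition Di := {malg k[basis]}.

Lemma letter_subproof (x : X) : is_basis (ucm x, 1%N).
Proof. by rewrite /is_basis inE /= mdegU. Qed.

Definition letter (x : X) : basis := Sub (ucm x, 1%N) (letter_subproof x).

Lemma bdashv_subproof (a b : basis) : is_basis (mmul (bword a) (bword b), 1%N).
Proof.
have /andP[a0 _] := valP a.
by rewrite /is_basis inE /= mdegM andbT ltn_addr.
Qed.

Lemma bvdash_subproof (a b : basis) :
  is_basis (mmul (bword a) (bword b),
            if mdeg (mmul (bword a) (bword b)) == 2%N then 2%N else 1%N).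
Proof.
have /andP[ab0 _] := bdashv_subproof a b.
by rewrite /is_basis ab0 /=; case: ifP => // ->.
Qed.

Definition bdashv (a b : basis) : basis := Sub _ (bdashv_subproof a b).
Definition bvdash (a b : basis) : basis := Sub _ (bvdash_subproof a b).

Definition bilinear_ext (op : basis -> basis -> basis) (f g : Di) : Di :=
  \sum_(a <- msupp f) \sum_(b <- msupp g) << f@_a * g@_b *g op a b >>.

Definition dashv : Di -> Di -> Di := bilinear_ext bdashv.
Definition vdash : Di -> Di -> Di := bilinear_ext bvdash.

Definition ideal (I : Di -> Prop) : Prop :=
  [/\ I 0,
      forall f g, I f -> I g -> I (f + g),
      forall (c : k) f, I f -> I (c *: f)
    & forall f r, I f ->
        [/\ I (vdash f r), I (vdash r f), I (dashv f r) & I (dashv r f)]].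

Definition Id (S : {pred Di}) (f : Di) : Prop :=
  forall I : Di -> Prop, ideal I -> {in S, forall s, I s} -> I f.

(* lt u v means u < v; blt is the induced monomial-center ordering. *)
Variable lt : rel {cmonom X}.

Definition blt (a b : basis) : bool :=
  lt (bword a) (bword b) || (bword a == bword b) && (bidx a < bidx b)%N.

(* None encodes the leading monomial (or leading word) of 0: it lies strictly
   below every Some. *)
Definition olt (T : Type) (r : rel T) (a b : option T) : bool :=
  match a, b with
  | Some x, Some y => r x y
  | None, Some _ => true
  | _, None => false
  end.

Definition ole (T : eqType) (r : rel T) (a b : option T) : bool :=
  (a == b) || olt r a b.

Definition lead (f : Di) : option basis :=
  ohead [seq a <- msupp f | all (fun b => (b == a) || blt b a) (msupp f)].

Definition lead_word (f : Di) : option {cmonom X} := omap bword (lead f).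
Definition lead_len (f : Di) : nat := oapp (fun a => mdeg (bword a)) 0%N (lead f).
Definition lc (f : Di) : k := oapp (fun a => f@_a) 0 (lead f).

Definition rest (f : Di) : Di :=
  f - oapp (fun a => lc f *: << a >>) 0 (lead f).

Definition monic (f : Di) : bool := lc f == 1.

Definition strong (f : Di) : bool :=
  (f != 0) && olt lt (lead_word (rest f)) (lead_word f).

(* normal s b m p : the normal s-polynomial [sb]_m exists and is equal to p.
   The basis element a in normal_dashv is [b]_1 with b a nonempty word. *)
Inductive normal (s : Di) : {cmonom X} -> nat -> Di -> Prop :=
| normal_self a : lead s = Some a -> normal s mone (bidx a) s
| normal_vdash (x : X) :
    lead_len s = 1%N -> normal s (ucm x) 2 (vdash s << letter x >>)
| normal_dashv (a : basis) :
    strong s -> bidx a = 1%N -> normal s (bword a) 1 (dashv s << a >>).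

Definition word_dvd (u w : {cmonom X}) : Prop := exists v, w = mmul u v.

Definition is_lcm (u v w : {cmonom X}) : Prop :=
  [/\ word_dvd u w, word_dvd v w
    & forall w', word_dvd u w' -> word_dvd v w' -> word_dvd w w'].

(* comp1 f c : c is a composition of the single polynomial f. *)
Inductive comp1 (f : Di) : Di -> Prop :=
| comp_nonstrong_vdash (x : X) :
    f != 0 -> ~~ strong f -> comp1 f (vdash f << letter x >>)
| comp_nonstrong_dashv (x : X) :
    f != 0 -> ~~ strong f -> comp1 f (dashv f << letter x >>)
| comp_strong (x y : X) :
    strong f -> (1 < lead_len f)%N -> letter y \in msupp f ->
    comp1 f (vdash f << letter x >> - dashv f << letter x >>).

(* comp2 f g c : c is a composition of the pair (f, g). *)
Inductive comp2 (f g : Di) : Di -> Prop :=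
| comp_same_lead :
    f != g -> lead f = lead g -> comp2 f g (f - g)
| comp_letter (x : X) m p :
    lead_len f = 2%N -> lead_len g = 1%N ->
    normal g (ucm x) m p -> lead f = lead p ->
    comp2 f g (f - p)
| comp_same_word (x : X) p q :
    strong f -> strong g -> (3 < lead_len f + lead_len g)%N ->
    lead f <> lead g -> lead_word f = lead_word g ->
    normal f (ucm x) 1 p -> normal g (ucm x) 1 q ->
    comp2 f g (p - q)
| comp_lcm u v w a b p q :
    strong f -> strong g -> (3 < lead_len f + lead_len g)%N ->
    lead_word f = Some u -> lead_word g = Some v -> u <> v ->
    is_lcm u v w -> w = mmul u a -> w = mmul v b -> b \in nonempty_word ->
    (mdeg w < lead_len f + lead_len g)%N ->
    normal f a 1 p -> normal g b 1 q ->
    comp2 f g (p - q).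

Definition normal_S (S : {pred Di}) (p : Di) : Prop :=
  exists s b m, s \in S /\ normal s b m p.

Definition trivial_mod (S : {pred Di}) (h : Di) : Prop :=
  exists2 l : seq (k * Di),
    h = \sum_(t <- l) t.1 *: t.2
  & {in l, forall t,
      normal_S S t.2 /\ (t.1 != 0 -> ole blt (lead t.2) (lead h))}.

Definition groebner_shirshov (S : {pred Di}) : Prop :=
  [/\ {in S, forall s, monic s},
      {in S, forall f c, comp1 f c -> trivial_mod S c}
    & {in S &, forall f g c, comp2 f g c -> trivial_mod S c}].

Inductive one_step (S : {pred Di}) (f : Di) : Di -> Prop :=
| OneStep a g b m p :
    a \in msupp f -> g \in S -> normal g b m p -> lead p = Some a ->
    one_step S f (f - (f@_a / lc g) *: p).

Definition reducible (S : {pred Di}) (f : Di) : Prop :=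
  exists a p, [/\ a \in msupp f, normal_S S p & lead p = Some a].

Definition remainder (S : {pred Di}) (f h : Di) : Prop :=
  clos_refl_trans _ (one_step S) f h /\ ~ reducible S h.

Definition item : Type := (Di + Di * Di)%type.

Definition composition (u : item) (c : Di) : Prop :=
  match u with inl f => comp1 f c | inr (f, g) => comp2 f g c end.

(* A state of the algorithm: the sets S and G, the set of the items of G that
   have been selected so far, and the list of those compositions of the last
   selected item that are still to be treated. *)
Record state := State {
  st_S : {fset Di};
  st_G : {fset item};
  st_selected : {fset item};
  st_todo : seq Di
}.

Definition init (F : {fset Di}) : state :=
  let S := [fset (lc f)^-1 *: f | f in F & f != 0] in
  State S
    ([fset (inl s : item) | s in S] `|`
     [fset (inr (s, g) : item) | s in S, g in S])
    fset0 [::].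

(* The items, the compositions of an item, and the remainder of a composition
   are chosen arbitrarily; cs is any finite listing of the compositions of u. *)
Inductive step : state -> state -> Prop :=
| step_select (S : {fset Di}) (G D : {fset item}) (u : item) (cs : seq Di) :
    u \in G -> u \notin D ->
    (forall c : Di, c \in cs <-> composition u c) ->
    step (State S G D [::]) (State S G (u |` D) cs)
| step_zero (S : {fset Di}) (G D : {fset item}) (c : Di) cs :
    remainder [in S] c 0 ->
    step (State S G D (c :: cs)) (State S G D cs)
| step_add (S : {fset Di}) (G D : {fset item}) (c : Di) cs r
    (h := (lc r)^-1 *: r) :
    remainder [in S] c r -> r != 0 ->
    step (State S G D (c :: cs))
      (State (h |` S)
         (G `|` [fset (inl h : item)]
            `|` [fset (inr (h, s) : item) | s in S]
            `|` [fset (inr (s, h) : item) | s in S])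
         D cs).

Definition reachable (F : {fset Di}) (st : state) : Prop :=
  clos_refl_trans _ step (init F) st.

Definition final (st : state) : bool :=
  (st_G st `<=` st_selected st) && (st_todo st == [::]).

End FreeDialgebra.

(* Main.v *)
Require Import Defs.
From mathcomp Require Import all_boot all_algebra.
From Stdlib Require Import Relation_Operators ClassicalEpsilon.

(** Why the algorithm is correct and stops.

    A Groebner-Shirshov basis is defined by the triviality of its compositions,
    so for correctness it suffices to follow one composition c, which is
    treated by reducing it to a remainder r.  Each reduction step subtracts a
    multiple of a normal S-polynomial whose leading monomial already lies in
    the support, hence below the leading monomial of c; adding up the steps
    writes c as a combination of such normal polynomials plus r, and r is
    either 0 or a multiple of the polynomial that is put into S.  So c is
    trivial modulo the new S [reduces_trivial_mod], and it stays trivial when S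
    grows.  Compositions and remainders of elements of an ideal lie in that
    ideal, so the ideals containing F are exactly those containing S.  All of
    this is collected in one invariant of the executions [step_invariant].

    Remainders exist because reduction is well founded [one_step_wf]: a step
    trades a basis element for smaller ones, and the monomial-center ordering is
    a well-ordering.  Since X is finite, a polynomial or a pair has only
    finitely many compositions [composition_listing]; hence an execution is
    never stuck.

    Termination is Dickson's lemma.  A polynomial h that enters S is irreducible
    modulo S, so its leading monomial is not that of a normal S-polynomial.  In
    an infinite run of additions, some subsequence has leading words that form
    a chain for divisibility and nondecreasing indices.  Distinct leading
    monomials force the lengths in the chain to grow, and from length 3 on only
    the index 1 occurs.  A polynomial whose leading monomial has index 1 is
    strong, so it has a normal multiple with any proper multiple of its leading
    word as leading word: the next term of the chain was reducible, a
    contradiction [extension_wf].  Between two additions, either the number of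
    unselected items drops or the list of compositions to be treated
    shrinks [step_decreases]. *)

Set Implicit Arguments.
Unset Strict Implicit.
Unset Printing Implicit Defensive.

Import GRing.Theory.

Local Open Scope fset_scope.
Local Open Scope ring_scope.

(** * The monomial-center ordering *)

Section Order.
Variables (X : choiceType) (lt : rel {cmonom X}).
Hypothesis lt_monomial : monomial_order lt.
Implicit Types a b c : basis X.

Lemma bword_nonempty a : bword a \in @nonempty_word X.
Proof. by case/andP: (valP a). Qed.

Lemma bidx_cases a : bidx a = 1%N \/ bidx a = 2%N /\ mdeg (bword a) = 2%N.
Proof. by case/andP: (valP a) => _ /orP[/eqP|/andP[/eqP ? /eqP ?]]; auto. Qed.

Lemma basis_eq a b : bword a = bword b -> bidx a = bidx b -> a = b.
Proof.
by move=> eq_w eq_i; apply/val_inj/eqP; rewrite -pair_eqE; apply/andP; split;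
   apply/eqP.
Qed.

Definition basis_le a b := (a == b) || blt lt a b.

Local Notation ble := basis_le.

Lemma blt_irr a : blt lt a a = false.
Proof.
rewrite /blt ltnn andbF orbF.
exact: (mo_irr lt_monomial (bword_nonempty a)).
Qed.

Lemma blt_trans : transitive (blt lt).
Proof.
move=> b a c; rewrite /blt.
move=> /orP[ab|/andP[/eqP-> ab]] /orP[bc|/andP[/eqP eq_bc bc]]; apply/orP.
- left; exact: (mo_trans lt_monomial (bword_nonempty b) (bword_nonempty a)
                         (bword_nonempty c) ab bc).
- by left; rewrite -eq_bc.
- by left.
- by right; rewrite eq_bc eqxx (ltn_trans ab bc).
Qed.

Lemma blt_total a b : a = b \/ blt lt a b \/ blt lt b a.
Proof.
case: (eqVneq (bword a) (bword b)) => [eq_w | neq_w].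
  rewrite /blt eq_w eqxx.
  by case: (ltngtP (bidx a) (bidx b)) => [_|_|/(basis_eq eq_w)];
     rewrite ?orbT; auto.
have /orP[] := mo_total lt_monomial (bword_nonempty a) (bword_nonempty b) neq_w;
  by rewrite /blt => ->; auto.
Qed.

Lemma ble_refl a : ble a a.
Proof. by rewrite /basis_le eqxx. Qed.

Lemma ble_trans : transitive ble.
Proof.
move=> b a c /orP[/eqP->//|ab] /orP[/eqP<-|bc]; apply/orP; right=> //.
exact: blt_trans ab bc.
Qed.

Lemma ble_anti a b : ble a b -> ble b a -> a = b.
Proof.
move=> /orP[/eqP//|ab] /orP[/eqP//|ba].
by have := blt_trans ab ba; rewrite blt_irr.
Qed.

(** Lexicographic descent: on words by the well-foundedness of the monomial
    order, and on indices for a fixed word. *)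
Lemma blt_wf : well_founded (blt lt).
Proof.
move=> a; move: {2}(bword a) (erefl (bword a)) => w.
elim: (mo_wf lt_monomial w) a => {}w _ IHw a.
have [n] := ubnP (bidx a); elim: n a => [a|n IHn a le_n eq_w]; first by rewrite ltn0.
constructor=> b.
move=> /orP[lt_w|/andP[/eqP eq_ba lt_i]].
  apply: (IHw (bword b)) => //.
  by rewrite -eq_w !bword_nonempty.
apply: IHn; last by rewrite eq_ba.
exact: leq_trans lt_i _.
Qed.

Lemma max_basis (s : seq (basis X)) :
  s != [::] -> exists2 a, a \in s & {in s, forall b, ble b a}.
Proof.
elim: s => // a s IHs _; case: (eqVneq s [::]) => [->|/IHs[m m_s max_m]].
  by exists a; rewrite ?mem_head // => b; rewrite inE => /eqP->; apply: ble_refl.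
have [le_am|lt_ma] : ble a m \/ blt lt m a.
  by rewrite /basis_le; case: (blt_total a m) => [->|[->|]]; rewrite ?eqxx ?orbT; auto.
  exists m; first by rewrite inE m_s orbT.
  by move=> b; rewrite inE => /predU1P[->|/max_m].
exists a; rewrite ?mem_head // => b; rewrite inE => /predU1P[->|/max_m le_bm].
  exact: ble_refl.
by apply: ble_trans le_bm _; rewrite /basis_le lt_ma orbT.
Qed.

(** The hypothesis compares words and not just basis elements: the symbols
    with indices 1 and 2 on one word have the same product by c.  This is why
    products of non-strong polynomials are not normal in general. *)
Lemma blt_bdashv a b c : lt (bword a) (bword b) -> blt lt (bdashv a c) (bdashv b c).
Proof.
by move=> lt_ab; apply/orP; left; apply: (mo_mul lt_monomial); rewrite ?bword_nonempty.
Qed.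

Lemma blt_bvdash a b c : lt (bword a) (bword b) -> blt lt (bvdash a c) (bvdash b c).
Proof.
by move=> lt_ab; apply/orP; left; apply: (mo_mul lt_monomial); rewrite ?bword_nonempty.
Qed.

End Order.

(** * Leading monomials and normal polynomials *)

Section Lead.
Variables (k : fieldType) (X : choiceType) (lt : rel {cmonom X}).
Hypothesis lt_monomial : monomial_order lt.
Implicit Types (f g s p : Di k X) (a b c : basis X).
Local Notation lead := (lead lt).
Local Notation ble := (basis_le lt).

Lemma leadE f a :
  lead f = Some a <-> a \in msupp f /\ {in msupp f, forall b, ble b a}.
Proof.
rewrite /Defs.lead; split=> [|[a_f max_a]].
  case def_s: [seq _ <- _ | _] => [//|c s] /= [<-{a}].
  have: c \in c :: s by rewrite mem_head.
  by rewrite -def_s mem_filter => /andP[/allP].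
case def_s: [seq _ <- _ | _] => [|c s] /=; last congr Some.
  suff: a \in [::] by [].
  by rewrite -def_s mem_filter a_f andbT; apply/allP.
have: c \in c :: s by rewrite mem_head.
rewrite -def_s mem_filter => /andP[/allP max_c c_f].
exact: (ble_anti lt_monomial) (max_a _ c_f) (max_c _ a_f).
Qed.

Lemma lead_supp f a : lead f = Some a -> a \in msupp f.
Proof. by case/leadE. Qed.

Lemma lead_max f a : lead f = Some a -> {in msupp f, forall b, ble b a}.
Proof. by case/leadE. Qed.

Lemma lead_exists f : f != 0 -> exists a, lead f = Some a.
Proof.
move=> nz_f; have [|a a_f max_a] := @max_basis X lt lt_monomial (msupp f).
  apply: contraNneq nz_f => s0; apply/eqP/malgP => b.
  by rewrite mcoeff0 mcoeff_outdom // -[_ \in _]/(b \in (msupp f : seq _)) s0.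
by exists a; apply/leadE.
Qed.

Lemma lead0 : lead (0 : Di k X) = None.
Proof. by rewrite /Defs.lead msupp0. Qed.

Lemma lead_nz f a : lead f = Some a -> f != 0.
Proof. by apply: contra_eq_neq => ->; rewrite lead0. Qed.

Lemma lc_lead f a : lead f = Some a -> lc lt f = f@_a.
Proof. by rewrite /lc => ->. Qed.

Lemma lc_neq0 f : f != 0 -> lc lt f != 0.
Proof.
case/lead_exists=> a lead_a; rewrite (lc_lead lead_a) mcoeff_neq0.
exact: lead_supp.
Qed.

Lemma leadZ (c : k) f : c != 0 -> lead (c *: f) = lead f.
Proof. by move=> nz_c; rewrite /Defs.lead msuppZ (negPf nz_c). Qed.

Lemma monic_normalized f : f != 0 -> Defs.monic lt ((lc lt f)^-1 *: f).
Proof.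
move=> nz_f; have nz_c := lc_neq0 nz_f; have [a lead_a] := lead_exists nz_f.
rewrite /Defs.monic (@lc_lead _ a) ?leadZ ?invr_eq0 //.
by rewrite mcoeffZ -(lc_lead lead_a) mulVf.
Qed.

(** Strength says that the leading word occurs in f only once.  This form,
    without the rest of f, is the one that makes products by a basis element
    keep the leading monomial. *)
Lemma strongP f a : lead f = Some a ->
  (strong lt f <-> {in msupp f, forall b, b <> a -> lt (bword b) (bword a)}).
Proof.
move=> lead_a; have nz_f := lead_nz lead_a.
rewrite /strong nz_f /= /rest /lead_word lead_a /= (lc_lead lead_a).
set r := f - _; have rE b : r@_b = if a == b then 0 else f@_b.
  rewrite mcoeffB mcoeffZ mcoeffU; case: eqVneq => [->|_].
    by rewrite mulr1 subrr.
  by rewrite mulr0 subr0.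
have r_f b : (b \in msupp r) = (b != a) && (b \in msupp f).
  by rewrite -!mcoeff_neq0 rE (eq_sym b); case: (a == b); rewrite ?eqxx.
have [r0|nz_r] := eqVneq r 0.
  rewrite r0 lead0; split=> // _ b b_f /eqP neq_ba.
  by have := r_f b; rewrite r0 msupp0 b_f neq_ba.
have [c lead_c] := lead_exists nz_r; rewrite lead_c /=.
have := lead_supp lead_c; rewrite r_f => /andP[/eqP neq_ca c_f].
split=> [lt_ca b b_f /eqP neq_ba | ->//].
have /(lead_max lead_c)/orP[/eqP->//|/orP[lt_bc|/andP[/eqP->//]]] : b \in msupp r.
  by rewrite r_f neq_ba.
by apply: (mo_trans lt_monomial) lt_bc lt_ca; apply: bword_nonempty.
Qed.

(** The common form of the products of f by a basis element on the right: each
    term moves along a map phi of basis elements, and the coefficients of terms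
    that collide add up. *)
Definition pushforward (phi : basis X -> basis X) f : Di k X :=
  \sum_(b <- msupp f) << f@_b *g phi b >>.

Lemma dashvU f a : dashv f << a >> = pushforward (fun b => bdashv b a) f.
Proof.
by apply: eq_bigr => b _; rewrite msuppU oner_eq0 big_seq_fset1 mcoeffUU mulr1.
Qed.

Lemma vdashU f a : vdash f << a >> = pushforward (fun b => bvdash b a) f.
Proof.
by apply: eq_bigr => b _; rewrite msuppU oner_eq0 big_seq_fset1 mcoeffUU mulr1.
Qed.

(** The image of the leading monomial strictly dominates all the other images,
    so its coefficient receives no other contribution and cannot cancel; the
    images of the smaller terms may collide freely. *)
Lemma pushforward_lead phi f a : lead f = Some a ->
    {in msupp f, forall b, b <> a -> blt lt (phi b) (phi a)} ->
  lead (pushforward phi f) = Some (phi a) /\ (pushforward phi f)@_(phi a) = f@_a.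
Proof.
move=> lead_a phi_mono; have a_f := lead_supp lead_a.
have coefE c : (pushforward phi f)@_c = \sum_(b <- msupp f) f@_b *+ (phi b == c).
  by rewrite raddf_sum; apply: eq_bigr => b _; apply: mcoeffU.
have coef_a : (pushforward phi f)@_(phi a) = f@_a.
  rewrite coefE (big_fsetD1 a a_f) /= eqxx mulr1n big_seq big1 ?addr0 // => b.
  rewrite in_fsetD1 => /andP[/eqP neq_ba b_f]; case: eqP => // eq_phi.
  by have := phi_mono b b_f neq_ba; rewrite eq_phi (blt_irr lt_monomial).
split=> //; apply/leadE; split; first by rewrite -mcoeff_neq0 coef_a mcoeff_neq0.
move=> c; rewrite -mcoeff_neq0 coefE => nz_c.
have [/hasP[b b_f /eqP<-]|/hasPn none] := boolP (has (fun b => phi b == c) (msupp f)).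
  case: (eqVneq b a) => [->|/eqP neq_ba]; first exact: ble_refl.
  by rewrite /basis_le phi_mono ?orbT.
case/eqP: nz_c; rewrite big_seq big1 // => b b_f.
by rewrite (negPf (none b b_f)).
Qed.

(** A one-letter word carries only the index 1, so it cannot occur twice in a
    polynomial. *)
Lemma lead_letter_lt f a :
  lead f = Some a -> mdeg (bword a) = 1%N ->
  {in msupp f, forall b, b <> a -> lt (bword b) (bword a)}.
Proof.
move=> lead_a a1 b b_f neq_ba.
have /orP[/eqP//|/orP[//|/andP[/eqP eq_w lt_i]]] := lead_max lead_a b_f.
case: (bidx_cases a) => [i1|[_]]; last by rewrite a1.
by case: (bidx_cases b) => [i2|[i2 _]]; rewrite i1 i2 in lt_i.
Qed.

(** The other symbol on the same word would have index 2 and exceed the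
    leading monomial. *)
Lemma idx1_strong f a : lead f = Some a -> bidx a = 1%N -> strong lt f.
Proof.
move=> lead_a a1; apply/(strongP lead_a) => b b_f neq_ba.
have /orP[/eqP//|/orP[//|/andP[_]]] := lead_max lead_a b_f.
by rewrite a1; case: (bidx_cases b) => [->|[-> _]].
Qed.

(** The notation for normal polynomials is faithful: the leading monomial of a
    normal s-polynomial is the symbol obtained by multiplying the leading word
    of s, with the announced index, and the leading coefficient is that
    of s. *)
Lemma normal_lead s u m p : normal lt s u m p ->
  exists a c, [/\ lead s = Some a, lead p = Some c, p@_c = s@_a &
    bword c = mmul (bword a) u /\ bidx c = m].
Proof.
case=> [a lead_a | x | a strong_s a1].
- by exists a, a; split; rewrite // mulm1.
- rewrite /lead_len; case lead_a: (lead s) => [a|//] /= a1.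
  have [|lead_p coef_p] := @pushforward_lead (fun b => bvdash b (letter x)) s a lead_a.
    move=> b b_s neq_ba.
    exact: (blt_bvdash lt_monomial) (lead_letter_lt lead_a a1 b_s neq_ba).
  exists a, (bvdash a (letter x)); rewrite vdashU; split=> //; split=> //.
  by rewrite /bidx /= mdegM a1 mdegU.
- case lead_c: (lead s) => [c|]; last first.
    case/andP: strong_s => /lead_exists[c]; by rewrite lead_c.
  have [|lead_p coef_p] := @pushforward_lead (fun b => bdashv b a) s c lead_c.
    move=> b b_s neq_bc; apply: (blt_bdashv lt_monomial).
    by apply: (proj1 (strongP lead_c)).
  by exists c, (bdashv c a); rewrite dashvU; split.
Qed.

End Lead.

(** * Reduction *)

Section Reduction.
Variables (k : fieldType) (X : choiceType) (lt : rel {cmonom X}).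
Hypothesis lt_monomial : monomial_order lt.
Implicit Types (S : {pred Di k X}) (f g s p h : Di k X) (a b c : basis X).
Local Notation lead := (lead lt).
Local Notation ble := (basis_le lt).

Lemma normal_coef_neq0 s u m p a :
  normal lt s u m p -> lead p = Some a -> p@_a = lc lt s /\ lc lt s != 0.
Proof.
move=> /(normal_lead lt_monomial)[b [c [lead_b lead_c coef_p _]]] lead_a.
have -> : a = c by apply/Some_inj; rewrite -lead_a.
by rewrite coef_p (lc_lead lead_b) mcoeff_neq0 (lead_supp lt_monomial lead_b).
Qed.

(** The last clause reuses the reducing polynomial on another r: a step on a sum
    that does not touch the support of a summand is a step on the rest. *)
Lemma one_stepE S f f' : one_step lt S f f' ->
  exists a g p, [/\ a \in msupp f, normal_S lt S p, lead p = Some a,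
    f' = f - (f@_a / lc lt g) *: p /\ f'@_a = 0
  & forall r, a \in msupp r -> one_step lt S r (r - (r@_a / lc lt g) *: p)].
Proof.
case=> a g u m p a_f g_S norm_p lead_p.
have [coef_p nz_g] := normal_coef_neq0 norm_p lead_p.
exists a, g, p; split=> // [||r a_r]; first by exists g, u, m.
  split=> //.
  by rewrite mcoeffB mcoeffZ coef_p divfK // subrr.
exact: OneStep a_r g_S norm_p lead_p.
Qed.

Lemma one_step_supp S f f' b : one_step lt S f f' -> b \in msupp f' ->
  exists2 a, a \in msupp f & ble b a.
Proof.
case/one_stepE=> a [g [p [a_f _ lead_p [-> _] _]]].
move=> /(fsubsetP (msuppB_le _ _)); rewrite in_fsetU => /orP[b_f|].
  by exists b; rewrite // ble_refl.
by move=> /(fsubsetP (msuppZ_le _ _)) /(lead_max lt_monomial lead_p); exists a.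
Qed.

(** By induction on a bound a of the support.  Write f as a multiple of a plus
    a polynomial r supported strictly below a.  A step on f either removes a,
    leaving a polynomial strictly below a, or is a step on r; the latter cannot
    go on forever since r itself is accessible. *)
Lemma one_step_wf S : well_founded (fun f' f => one_step lt S f f').
Proof.
set red := fun f' f => _.
have acc0 : Acc red 0 by constructor=> f' /one_stepE[a [g [p []]]]; rewrite msupp0.
suff acc_bounded a f : {in msupp f, forall b, ble b a} -> Acc red f.
  move=> f; have [->//|/(lead_exists lt_monomial)[a lead_a]] := eqVneq f 0.
  exact: acc_bounded (lead_max lt_monomial lead_a).
elim: (blt_wf lt_monomial a) f => {}a _ IHa f max_f.
have acc_below g : {in msupp g, forall b, blt lt b a} -> Acc red g.
  move=> below_g; have [->//|/(lead_exists lt_monomial)[b lead_b]] := eqVneq g 0.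
  exact: IHa (below_g b (lead_supp lt_monomial lead_b)) _ (lead_max lt_monomial lead_b).
(* Only the summand r is reduced by a step that keeps the multiple of a. *)
have acc_top r : Acc red r -> {in msupp r, forall b, blt lt b a} ->
    forall alpha, Acc red (alpha *: << a >> + r).
  elim=> {}r _ IHr below_r alpha.
  constructor=> f' step.
  have [c [g [p [c_f _ lead_p [def_f' f'c0] stepr]]]] := one_stepE step.
  have supp_top b : b \in msupp (alpha *: << a >> + r) -> b = a \/ b \in msupp r.
    move=> /(fsubsetP (msuppD_le _ _)); rewrite in_fsetU => /orP[|]; last by right.
    move=> /(fsubsetP (msuppZ_le _ _)) /(fsubsetP msuppU_le).
    by rewrite in_fset1 => /eqP; left.
  have [eq_ca|neq_ca] := eqVneq c a.
    apply: acc_below => b b_f'.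
    have [b' /supp_top b'_f le_bb'] := one_step_supp step b_f'.
    have /orP[/eqP eq_ba|//] : ble b a.
      case: b'_f => [<-//|/below_r lt_b'a]; apply: (ble_trans lt_monomial) le_bb' _.
      by rewrite /basis_le lt_b'a orbT.
    by move: b_f'; rewrite -mcoeff_neq0 eq_ba -eq_ca f'c0 eqxx.
  have c_r : c \in msupp r by case/supp_top: c_f => // /eqP; rewrite (negPf neq_ca).
  have coef_c : (alpha *: << a >> + r)@_c = r@_c.
    by rewrite mcoeffD mcoeffZ mcoeffU eq_sym (negPf neq_ca) mulr0 add0r.
  rewrite def_f' coef_c -addrA; apply: (IHr _ (stepr r c_r)) => b b_r'.
  have [b' /below_r lt_b'a /orP[/eqP->//|lt_bb']] := one_step_supp (stepr r c_r) b_r'.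
  exact: (blt_trans lt_monomial) lt_bb' lt_b'a.
have below_rest : {in msupp (f - f@_a *: << a >>), forall b, blt lt b a}.
  move=> b; rewrite -mcoeff_neq0 mcoeffB mcoeffZ mcoeffU.
  have [<-|neq_ab] := eqVneq a b; first by rewrite mulr1 subrr eqxx.
  rewrite mulr0 subr0 mcoeff_neq0 => /max_f /orP[/eqP eq_ba|//].
  by rewrite eq_ba eqxx in neq_ab.
rewrite -[f](subrK (f@_a *: << a >>)) addrC.
exact: acc_top (acc_below _ below_rest) below_rest _.
Qed.

(** Each step removes a basis element that is at most the initial bound a, and
    the steps never raise the bound. *)
Lemma reduces_combination S f h a :
    clos_refl_trans _ (one_step lt S) f h -> {in msupp f, forall b, ble b a} ->
  {in msupp h, forall b, ble b a} /\
  exists2 l : seq (k * Di k X), f = \sum_(t <- l) t.1 *: t.2 + h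
    & {in l, forall t, normal_S lt S t.2 /\ ole (blt lt) (lead t.2) (Some a)}.
Proof.
elim=> {f h} [f f' step | f | f g h _ IHf _ IHg] max_f.
- split=> [b b_f'|].
    have [b' /max_f le_b'a le_bb'] := one_step_supp step b_f'.
    exact: (ble_trans lt_monomial) le_bb' le_b'a.
  have [b [g [p [b_f norm_p lead_p [-> _] _]]]] := one_stepE step.
  exists [:: (f@_b / lc lt g, p)]; first by rewrite big_seq1 addrC subrK.
  by move=> t; rewrite inE => /eqP->; rewrite lead_p; split=> //; apply: max_f.
- by split=> //; exists [::] => //; rewrite big_nil add0r.
- have [max_g [lf -> normal_lf]] := IHf max_f.
  have [max_h [lg -> normal_lg]] := IHg max_g.
  split=> //; exists (lf ++ lg); first by rewrite big_cat addrA.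
  by move=> t; rewrite mem_cat => /orP[/normal_lf|/normal_lg].
Qed.

Lemma normal_S_sub S S' p : {subset S <= S'} -> normal_S lt S p -> normal_S lt S' p.
Proof. by move=> sub_S [s [u [m [s_S norm_p]]]]; exists s, u, m; split; auto. Qed.

Lemma trivial_mod_sub S S' h :
  {subset S <= S'} -> trivial_mod lt S h -> trivial_mod lt S' h.
Proof.
move=> sub_S [l -> normal_l]; exists l => // t /normal_l[norm_t le_t].
by split=> //; apply: normal_S_sub norm_t.
Qed.

(** The remainder h is allowed to be any multiple of an element of the larger
    set S'; the multiple 0 covers a zero remainder, and otherwise h contributes
    one more normal polynomial, namely s itself. *)
Lemma reduces_trivial_mod S S' f h (alpha : k) s :
    {subset S <= S'} -> clos_refl_trans _ (one_step lt S) f h ->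
    h = alpha *: s -> (alpha != 0 -> s \in S' /\ s != 0) ->
  trivial_mod lt S' f.
Proof.
move=> sub_S red_f def_h s_S'.
have [->|/(lead_exists lt_monomial)[a lead_a]] := eqVneq f 0.
  by exists [::]; rewrite ?big_nil.
have [max_h [l def_f normal_l]] :=
  reduces_combination red_f (lead_max lt_monomial lead_a).
have l_ok : {in l, forall t,
    normal_S lt S' t.2 /\ (t.1 != 0 -> ole (blt lt) (lead t.2) (lead f))}.
  by rewrite lead_a => t /normal_l[norm_t le_t]; split=> //; apply: normal_S_sub norm_t.
have [alpha0|nz_alpha] := eqVneq alpha 0.
  by exists l => //; rewrite {1}def_f def_h alpha0 scale0r addr0.
have {s_S'}[s_S' nz_s] := s_S' nz_alpha.
have [b lead_b] := lead_exists lt_monomial nz_s.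
exists ((alpha, s) :: l); first by rewrite big_cons /= -def_h addrC.
move=> t; rewrite inE => /predU1P[->/=|]; last exact: l_ok.
split; first by exists s, (mone : {cmonom X}), (bidx b); split=> //; constructor.
move=> _; rewrite lead_b lead_a; apply: max_h; apply: (lead_supp lt_monomial).
by rewrite def_h leadZ.
Qed.

Lemma remainder_exists S f : exists h, remainder lt S f h.
Proof.
elim: (one_step_wf S f) => {}f _ IHf.
have [[a [p [a_f [s [u [m [s_S norm_p]]]] lead_p]]]|irr_f] :=
  classic (reducible lt S f).
  have step := OneStep a_f s_S norm_p lead_p.
  have [h [red_h irr_h]] := IHf _ step.
  by exists h; split=> //; apply: rt_trans red_h; apply: rt_step.
by exists f; split=> //; apply: rt_refl.
Qed.

End Reduction.

(** * Ideals *)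

Section Ideal.
Variables (k : fieldType) (X : choiceType) (lt : rel {cmonom X}).
Variables (I : Di k X -> Prop) (ideal_I : ideal I).
Implicit Types (S : {pred Di k X}) (f g s p h : Di k X).

Lemma idealZ (c : k) f : I f -> I (c *: f).
Proof. by case: ideal_I => _ _ + _; apply. Qed.

Lemma idealB f g : I f -> I g -> I (f - g).
Proof.
move=> If Ig; rewrite -scaleN1r; case: ideal_I => _ ID _ _.
by apply: ID => //; apply: idealZ.
Qed.

Lemma ideal_dashv f g : I f -> I (dashv f g).
Proof. by move=> If; case: ideal_I => _ _ _ /(_ f g If)[]. Qed.

Lemma ideal_vdash f g : I f -> I (vdash f g).
Proof. by move=> If; case: ideal_I => _ _ _ /(_ f g If)[]. Qed.

Lemma ideal_normal s u m p : normal lt s u m p -> I s -> I p.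
Proof.
by case=> [a _|x _|a _ _] Is //; [apply: ideal_vdash | apply: ideal_dashv].
Qed.

Lemma ideal_comp1 f c : comp1 lt f c -> I f -> I c.
Proof.
case=> [x _ _|x _ _|x y _ _ _] If; [exact: ideal_vdash | exact: ideal_dashv |].
by apply: idealB; [exact: ideal_vdash | exact: ideal_dashv].
Qed.

Lemma ideal_comp2 f g c : comp2 lt f g c -> I f -> I g -> I c.
Proof.
by case=> [_ _|x m p _ _ /ideal_normal Ip _|x p q _ _ _ _ _ /ideal_normal Ip
  /ideal_normal Iq|u v w a b p q _ _ _ _ _ _ _ _ _ _ _ /ideal_normal Ip
  /ideal_normal Iq] If Ig; apply: idealB; auto.
Qed.

Lemma ideal_reduces S f h : {in S, forall s, I s} ->
  clos_refl_trans _ (one_step lt S) f h -> I f -> I h.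
Proof.
move=> IS; elim=> {f h} [f f' [a g u m p _ g_S norm_p _] If | //
                        | f g h _ Hfg _ Hgh /Hfg//].
by apply: idealB => //; apply/idealZ/(ideal_normal norm_p)/IS.
Qed.

End Ideal.

(** * Finiteness of the set of compositions *)

Section FinitePredicates.
Variable T : eqType.
Implicit Types P Q : T -> Prop.

(** A finite list containing all solutions, possibly with others: inclusion is
    what the syntax of compositions gives, and excluded middle turns it into an
    exact listing. *)
Definition finitely_many P := exists l : seq T, forall c, P c -> c \in l.

Lemma finitely_many_listing P :
  finitely_many P -> exists l : seq T, forall c, c \in l <-> P c.
Proof.
case=> l sub_l; exists [seq c <- l | excluded_middle_informative (P c)] => c.
rewrite mem_filter; case: excluded_middle_informative => Pc /=.
  by split=> // _; apply: sub_l.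
by split.
Qed.

Lemma finitely_many_sub P Q :
  (forall c, P c -> Q c) -> finitely_many Q -> finitely_many P.
Proof. by move=> sub_PQ [l sub_l]; exists l; auto. Qed.

Lemma finitely_many_or P Q :
  finitely_many P -> finitely_many Q -> finitely_many (fun c => P c \/ Q c).
Proof.
move=> [l1 sub1] [l2 sub2]; exists (l1 ++ l2) => c; rewrite mem_cat.
by case=> [/sub1->//|/sub2->]; rewrite orbT.
Qed.

Lemma finitely_many_uniq P :
  (forall c c', P c -> P c' -> c = c') -> finitely_many P.
Proof.
move=> uniqP; have [[c Pc]|noP] := classic (exists c, P c).
  by exists [:: c] => c' Pc'; rewrite (uniqP _ _ Pc' Pc) mem_head.
by exists [::] => c Pc; case: noP; exists c.
Qed.

Lemma finitely_many_eq d : finitely_many (fun c => c = d).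
Proof. by exists [:: d] => c ->; apply: mem_head. Qed.

Lemma finitely_many_ex (I : finType) (P : I -> T -> Prop) :
  (forall i, finitely_many (P i)) -> finitely_many (fun c => exists i, P i c).
Proof.
move=> finP; suff [l sub_l]: finitely_many (fun c => exists2 i, i \in enum I & P i c).
  by exists l => c [i Pi]; apply: sub_l; exists i; rewrite ?mem_enum.
elim: (enum I) => [|i s IHs]; first by exists [::] => c [].
apply: finitely_many_sub (finitely_many_or (finP i) IHs) => c [j].
by rewrite inE => /predU1P[->|]; [left | right; exists j].
Qed.

End FinitePredicates.

Section Words.
Variable X : choiceType.
Implicit Types u v w : {cmonom X}.

Lemma mmulI u v w : mmul u v = mmul u w -> v = w.
Proof.
move=> eq_uv; apply/eqP/cmP=> x; apply/eqP.
have /eqP := cmM x u v.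
by rewrite eq_uv cmM eqn_add2l eq_sym.
Qed.

Lemma word_dvd_anti u v : word_dvd u v -> word_dvd v u -> u = v.
Proof.
move=> [a ->] [b]; rewrite -mulmA -{1}[u]mulm1 => /mmulI/esym/unitm[-> _].
by rewrite mulm1.
Qed.

Lemma is_lcm_uniq u v w w' : is_lcm u v w -> is_lcm u v w' -> w = w'.
Proof.
by move=> [uw vw min_w] [uw' vw' min_w']; apply: word_dvd_anti; auto.
Qed.

Lemma word_dvdP u v : (forall x, u x <= v x)%N -> word_dvd u v.
Proof.
move=> le_uv; exists (divcm v u); apply/eqP/cmP=> x.
by rewrite cmM divcmE subnKC.
Qed.

End Words.

Section Finiteness.
Variables (k : fieldType) (X : finType) (lt : rel {cmonom X}).
Implicit Types (f g s p h c : Di k X) (u : {cmonom X}) (x : X).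

Lemma nonempty_neq1 u : u \in @nonempty_word X -> u <> mone.
Proof. by move=> + u1; rewrite u1 inE mdeg1. Qed.

Lemma ucm_inj : injective (@ucm X).
Proof.
by move=> x y eq_xy; have := cmUU x; rewrite eq_xy cmU; case: eqP.
Qed.

(** The symbol of a normal polynomial determines it.  Hence, for f and g fixed,
    a composition is determined by the letter or the words involved. *)
Lemma normal_uniq s u m p p' : normal lt s u m p -> normal lt s u m p' -> p = p'.
Proof.
suff uniq u' m' :
    normal lt s u m p -> normal lt s u' m' p' -> u = u' -> m = m' -> p = p'.
  by move=> norm_p norm_p'; apply: uniq norm_p norm_p' _ _.
case=> [a _|x _|a _ a1] [b _|y _|b _ b1].
- by move=> _ _.
- by move=> eq_u; have := mdegU y; rewrite -eq_u mdeg1.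
- by move=> /esym/(nonempty_neq1 (bword_nonempty b)).
- by move=> eq_u; have := mdegU x; rewrite eq_u mdeg1.
- by move=> /ucm_inj->.
- by move=> _ eq_m; discriminate eq_m.
- by move=> /(nonempty_neq1 (bword_nonempty a)).
- by move=> _ eq_m; discriminate eq_m.
- by move=> eq_ab _; congr (dashv _ << _ >>); apply: basis_eq; rewrite ?a1.
Qed.

Lemma normal_idx s u m p : normal lt s u m p -> (m < 3)%N.
Proof. by case=> // a _; case: (bidx_cases a) => [->|[->]]. Qed.

Lemma comp1_finite f : finitely_many (comp1 lt f).
Proof.
apply: (@finitely_many_sub _ _ (fun c => exists x,
  c = vdash f << letter x >> \/ c = dashv f << letter x >> \/
  c = vdash f << letter x >> - dashv f << letter x >>)).
  by move=> c [x _ _|x _ _|x y _ _ _]; exists x; [left | right; left | right; right].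
apply: finitely_many_ex => x.
by do 2?[apply: finitely_many_or]; apply: finitely_many_eq.
Qed.

(** The part of the data of an lcm composition that determines its value. *)
Definition lcm_comp f g c := exists u v w a b p q,
  [/\ lead_word lt f = Some u, lead_word lt g = Some v, is_lcm u v w,
      w = mmul u a /\ w = mmul v b
    & [/\ normal lt f a 1 p, normal lt g b 1 q & c = p - q]].

(** A least common multiple is unique because the only invertible word is the
    empty one, and cancellation then determines both cofactors. *)
Lemma lcm_comp_uniq f g c c' : lcm_comp f g c -> lcm_comp f g c' -> c = c'.
Proof.
move=> [u [v [w [a [b [p [q [fu gv lcm_w [wu wv] [norm_p norm_q ->]]]]]]]]].
move=> [u' [v' [w' [a' [b' [p' [q'
  [fu' gv' lcm_w' [wu' wv'] [norm_p' norm_q' ->]]]]]]]]].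
have eq_u : u = u' by apply/Some_inj; rewrite -fu.
have eq_v : v = v' by apply/Some_inj; rewrite -gv.
subst u' v'; have eq_w := is_lcm_uniq lcm_w lcm_w'.
have eq_a : a = a' by apply: (@mmulI _ u); rewrite -wu eq_w.
have eq_b : b = b' by apply: (@mmulI _ v); rewrite -wv eq_w.
subst a' b'; congr (_ - _); first exact: normal_uniq norm_p norm_p'.
exact: normal_uniq norm_q norm_q'.
Qed.

Lemma comp2_finite f g : finitely_many (comp2 lt f g).
Proof.
apply: (@finitely_many_sub _ _ (fun c => c = f - g \/
  (exists x (m : 'I_3), exists2 p, normal lt g (ucm x) m p & c = f - p) \/
  (exists x, exists p q,
     [/\ normal lt f (ucm x) 1 p, normal lt g (ucm x) 1 q & c = p - q]) \/
  lcm_comp f g c)).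
  move=> c [_ _|x m p _ _ norm_p _|x p q _ _ _ _ _ norm_p norm_q|].
  - by left.
  - by right; left; exists x, (Ordinal (normal_idx norm_p)), p.
  - by right; right; left; exists x, p, q.
  - move=> u v w a b p q _ _ _ fu gv _ lcm_w wu wv _ _ norm_p norm_q.
    by right; right; right; exists u, v, w, a, b, p, q.
apply: finitely_many_or; first exact: finitely_many_eq.
apply: finitely_many_or.
  apply: finitely_many_ex => x; apply: finitely_many_ex => m.
  apply: finitely_many_uniq => c c' [p norm_p ->] [p' norm_p' ->].
  by rewrite (normal_uniq norm_p norm_p').
apply: finitely_many_or; last exact: finitely_many_uniq (@lcm_comp_uniq f g).
apply: finitely_many_ex => x; apply: finitely_many_uniq => c c'.
move=> [p [q [norm_p norm_q ->]]] [p' [q' [norm_p' norm_q' ->]]].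
by rewrite (normal_uniq norm_p norm_p') (normal_uniq norm_q norm_q').
Qed.

Lemma composition_listing (u : item k X) :
  exists cs : seq (Di k X), forall c, c \in cs <-> composition lt u c.
Proof.
apply: finitely_many_listing.
by case: u => [f|[f g]]; [apply: comp1_finite | apply: comp2_finite].
Qed.

End Finiteness.

(** * Dickson's lemma *)

Section Dickson.

Definition increasing (g : nat -> nat) := {homo g : i j / (i < j)%N}.

Lemma tail_minimum (s : nat -> nat) n :
  exists m, (n <= m)%N /\ forall i, (n <= i)%N -> (s m <= s i)%N.
Proof.
have: (n <= n)%N by []; move: {2}n => m le_nm.
have [v] := ubnP (s m); elim: v m le_nm => // v IHv m le_nm le_sv.
have [[i [le_ni lt_si]]|min_m] := classic (exists i, (n <= i /\ s i < s m)%N).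
  by apply: (IHv i) => //; apply: leq_trans lt_si _.
exists m; split=> // i le_ni; rewrite leqNgt; apply/negP=> lt_si.
by case: min_m; exists i.
Qed.

(** Repeatedly pick an index, beyond the previous ones, where the values still
    to come are minimal. *)
Lemma monotone_subsequence (s : nat -> nat) :
  exists2 g, increasing g & {homo s \o g : i j / (i <= j)%N}.
Proof.
have [m mP] := ClassicalEpsilon.choice _ (tail_minimum s).
pose g := fix g i := m (if i is j.+1 then (g j).+1 else 0%N).
have incr_g : increasing g.
  by apply: homo_ltn => [|i]; [apply: ltn_trans | case: (mP (g i).+1)].
exists g => // i j le_ij /=.
have [n def_gi] : exists n, g i = m n by case: (i) => [|i']; eexists.
rewrite def_gi; apply: (proj2 (mP n)); apply: leq_trans (proj1 (mP n)) _.
rewrite -def_gi; exact: ltnW_homo.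
Qed.

(** Refine the subsequence once for each coordinate. *)
Lemma dickson (I : eqType) (l : seq I) (s : nat -> I -> nat) :
  exists2 g, increasing g
    & {in l, forall x, {homo (fun i => s (g i) x) : i j / (i <= j)%N}}.
Proof.
elim: l => [|x l [g incr_g mono_g]]; first by exists id.
have [g' incr_g' mono_g'] := monotone_subsequence (fun i => s (g i) x).
exists (g \o g') => [i j lt_ij|y]; first exact/incr_g/incr_g'.
rewrite inE => /predU1P[->//|/mono_g mono_y i j le_ij]; apply: mono_y.
exact: ltnW_homo le_ij.
Qed.

Lemma descending_chain (T : Type) (R : T -> T -> Prop) :
  ~ well_founded R -> exists s : nat -> T, forall i, R (s i.+1) (s i).
Proof.
move=> not_wf; have [x not_acc] : exists x, ~ Acc R x.
  apply: NNPP => all_acc; apply: not_wf => x.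
  by apply: NNPP => ?; apply: all_acc; exists x.
have next (y : {y | ~ Acc R y}) : exists z : {z | ~ Acc R z}, R (sval z) (sval y).
  case: y => y not_acc_y /=; apply: NNPP => none; apply: not_acc_y.
  constructor=> z Rzy; apply: NNPP => not_acc_z; apply: none.
  by exists (exist _ z not_acc_z).
have [f f_desc] := ClassicalEpsilon.choice _ next.
by exists (fun i => sval (iter i f (exist _ x not_acc))) => i; apply: f_desc.
Qed.

End Dickson.

(** * Extending a set by irreducible polynomials *)

Section Extension.
Variables (k : fieldType) (X : finType) (lt : rel {cmonom X}).
Hypothesis lt_monomial : monomial_order lt.
Implicit Types (S : {fset Di k X}) (f g s p h : Di k X) (a b c : basis X).

(** What the algorithm does to S when a remainder is nonzero. *)
Definition extension S' S :=
  exists h, [/\ S' = h |` S, h != 0 & ~ reducible lt [in S] h].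

Lemma word_basis (u : {cmonom X}) :
  u \in @nonempty_word X -> exists2 a, bword a = u & bidx a = 1%N.
Proof.
move=> u_neq; have u_basis : is_basis (u, 1%N) by rewrite /is_basis u_neq.
by exists (Sub (u, 1%N) u_basis).
Qed.

Lemma bidx_leq2 a : (1 <= bidx a <= 2)%N.
Proof. by case: (bidx_cases a) => [->|[->]]. Qed.

Lemma long_idx1 a : (4 < mdeg (bword a) + bidx a)%N -> bidx a = 1%N.
Proof. by case: (bidx_cases a) => [->|[-> ->]]. Qed.

(** Along an infinite chain, the leading monomial of a later addition differs
    from that of every normal polynomial of an earlier one.  Apply Dickson's
    lemma to the exponents of the leading word and to the index together: along
    the subsequence, the sum of length and index strictly increases.  Once it
    exceeds 4 the index is 1, and the earlier polynomial, being strong, has a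
    normal multiple with the leading monomial of the later one. *)
Lemma extension_wf : well_founded extension.
Proof.
apply: NNPP => /descending_chain[S ext_S].
have [|ha haP] := ClassicalEpsilon.choice (fun i (ha : Di k X * basis X) =>
    [/\ S i.+1 = ha.1 |` S i, lead lt ha.1 = Some ha.2
       & ~ reducible lt [in S i] ha.1]).
  move=> i; have [h [def_S /(lead_exists lt_monomial)[a lead_a] irr_h]] := ext_S i.
  by exists (h, a).
have h_in i j : (i < j)%N -> (ha i).1 \in S j.
  elim: j => // j IHj; have [-> _ _] := haP j.
  rewrite ltnS leq_eqVlt in_fset1U => /predU1P[->|/IHj->]; rewrite ?eqxx ?orbT //.
have irr i j u m p : (i < j)%N ->
    normal lt (ha i).1 u m p -> lead lt p <> Some (ha j).2.
  move=> lt_ij norm_p lead_p; have [_ lead_h] := haP j; case.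
  exists (ha j).2, p; split=> //; first exact: (lead_supp lt_monomial).
  by exists (ha i).1, u, m; split=> //; apply: h_in.
(* The coordinate None stands for the index of the basis element. *)
have [g incr_g mono_g] := dickson (enum {: option X})
  (fun i x => if x is Some y then bword (ha i).2 y else bidx (ha i).2).
pose b i := (ha (g i)).2; pose size_b i := (mdeg (bword (b i)) + bidx (b i))%N.
have b_dvd i j : (i <= j)%N -> word_dvd (bword (b i)) (bword (b j)).
  by move=> le_ij; apply: word_dvdP => x; apply: (mono_g (Some x)); rewrite ?mem_enum.
have b_neq i j : (i < j)%N -> b i <> b j.
  move=> /incr_g lt_g eq_b; have [_ lead_i _] := haP (g i).
  by apply: (irr _ _ _ _ _ lt_g (normal_self lead_i)); rewrite lead_i; congr Some.
have size_b_mono i : (size_b i < size_b i.+1)%N.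
  have [d def_b] := b_dvd _ _ (leqnSn i).
  have le_idx : (bidx (b i) <= bidx (b i.+1))%N.
    by apply: (mono_g None); rewrite ?mem_enum.
  rewrite ltnNge; apply/negP; rewrite /size_b def_b mdegM => le_size.
  apply: (b_neq i i.+1) => //; apply: basis_eq.
    suff /mdeg_eq0I d1 : mdeg d = 0%N by rewrite def_b d1 mulm1.
    apply/eqP; rewrite -leqn0 -(leq_add2l (mdeg (bword (b i)) + bidx (b i))) addn0.
    apply: leq_trans le_size; rewrite addnAC leq_add2l //.
  apply/eqP; rewrite eqn_leq le_idx -(leq_add2l (mdeg (bword (b i)))).
  by apply: leq_trans le_size; rewrite leq_add2r leq_addr.
have size_b_lb i : (i.+1 < size_b i)%N.
  elim: i => [|i IHi]; last exact: leq_ltn_trans IHi (size_b_mono i).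
  have := bword_nonempty (b 0%N); rewrite inE /size_b.
  by case/andP: (bidx_leq2 (b 0%N)) => i1 _ m1; rewrite -[2%N]/(1 + 1)%N leq_add.
(* At position 3 the sum of length and index is at least 5. *)
have b3 : bidx (b 3) = 1%N by apply/long_idx1/size_b_lb.
have b4 : bidx (b 4) = 1%N by apply: long_idx1; apply: ltnW (size_b_lb 4).
have [_ lead_3 _] := haP (g 3).
have [d def_b4] := b_dvd 3 4 isT.
have d_neq : d \in @nonempty_word X.
  rewrite inE lt0n; apply/eqP=> /mdeg_eq0I d1; apply: (b_neq 3 4) => //.
  by apply: basis_eq; rewrite ?b3 ?b4 // def_b4 d1 mulm1.
have [a def_d a1] := word_basis d_neq.
have norm_p := normal_dashv (idx1_strong lt_monomial lead_3 b3) a1.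
have [a3 [c [lead_a3 lead_c _ [def_c idx_c]]]] := normal_lead lt_monomial norm_p.
apply: (irr _ (g 4) _ _ _ (incr_g 3 4 isT) norm_p); rewrite lead_c; congr Some.
apply: basis_eq; rewrite ?idx_c -/(b 4) ?b4 // def_c def_b4 def_d.
by move: lead_a3; rewrite lead_3 => -[<-].
Qed.

End Extension.

(** * Executions of the algorithm *)

Section Algorithm.
Variables (k : fieldType) (X : finType) (lt : rel {cmonom X}).
Hypothesis lt_monomial : monomial_order lt.
Implicit Types (S F : {fset Di k X}) (G D : {fset item k X}).
Implicit Types (f g s h r c : Di k X) (st : state k X).

Lemma reducibleZ (S : {pred Di k X}) (alpha : k) f :
  reducible lt S (alpha *: f) -> reducible lt S f.
Proof.
move=> [a [p [a_f norm_p lead_p]]]; exists a, p; split=> //.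
exact: (fsubsetP (msuppZ_le _ _)) a_f.
Qed.

Lemma normalized_neq0 r : r != 0 -> (lc lt r)^-1 *: r != 0.
Proof. by move=> nz_r; rewrite scaler_eq0 invr_eq0 negb_or lc_neq0. Qed.

Definition pending st := #|` st_G st `\` st_selected st|.

(** A well-founded lexicographic descent: the set S, then the number of items
    that are not selected yet, then the list of compositions to be treated. *)
Lemma step_decreases st st' : step lt st st' ->
  [\/ extension lt (st_S st') (st_S st),
      st_S st' = st_S st /\ (pending st' < pending st)%N
    | [/\ st_S st' = st_S st, pending st' = pending st
        & (size (st_todo st') < size (st_todo st))%N]].
Proof.
case=> [S G D u cs u_G u_D _|S G D c cs _|S G D c cs r h [_ irr_r] nz_r].
- constructor 2; split=> //; apply: fproper_ltn_card.
  rewrite fproperEneq fsetDS ?fsubsetU1 // andbT.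
  apply: contraTneq u_G => eq_D; apply/negP=> u_G.
  have: u \in G `\` D by rewrite in_fsetD u_D.
  by rewrite -[_ `\` D]eq_D in_fsetD in_fset1U eqxx.
- by constructor 3.
- by constructor 1; exists h; split=> //; [apply: normalized_neq0 | move/reducibleZ].
Qed.

Lemma step_terminates st : Acc (fun st' st => step lt st st') st.
Proof.
have [S def_S] : exists S, st_S st = S by exists (st_S st).
elim: (extension_wf lt_monomial S) st def_S => {}S _ IHS st def_S.
have [n] := ubnP (pending st).
elim: n st def_S => [st _|n IHn st def_S lt_n]; first by rewrite ltn0.
have [m] := ubnP (size (st_todo st)).
elim: m st def_S lt_n => [st _ _|m IHm st def_S lt_n lt_m]; first by rewrite ltn0.
constructor=> st' /step_decreases[ext_S|[eq_S lt_st']|[eq_S eq_n lt_st']].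
- by apply: IHS (erefl _); rewrite -def_S.
- by apply: IHn; [rewrite eq_S | apply: leq_trans lt_st' _].
- by apply: IHm; [rewrite eq_S | rewrite eq_n | apply: leq_trans lt_st' _].
Qed.

Lemma step_progress st : ~~ final st -> exists st', step lt st st'.
Proof.
case: st => S G D [|c cs]; rewrite /final /=.
  rewrite andbT => /fsubsetPn[u u_G u_D].
  have [cs csP] := composition_listing lt u.
  by exists (State S G (u |` D) cs); constructor.
move=> _; have [r rem_r] := remainder_exists lt_monomial [in S] c.
have [r0|nz_r] := eqVneq r 0; last by eexists; apply: step_add rem_r nz_r.
by exists (State S G D cs); constructor; rewrite -r0.
Qed.

Definition item_in S (u : item k X) : Prop :=
  match u with inl s => s \in S | inr (s, t) => s \in S /\ t \in S end.

(** Pairs of equal polynomials are exempt in inv_pair since the algorithm never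
    adds the pair of a new polynomial with itself; such a pair has no
    composition.  In inv_ideal and inv_todo the ideal is arbitrary, which
    compares the two generated ideals without constructing them. *)
Record invariant F st : Prop := Invariant {
  inv_monic : {in st_S st, forall s, Defs.monic lt s};
  inv_single : {in st_S st, forall s, (inl s : item k X) \in st_G st};
  inv_pair : {in st_S st &, forall s t, s <> t -> (inr (s, t) : item k X) \in st_G st};
  inv_item : {in st_G st, forall u, item_in (st_S st) u};
  inv_ideal : forall I, ideal I ->
    ({in F, forall f, I f} <-> {in st_S st, forall s, I s});
  inv_todo : forall I, ideal I -> {in st_S st, forall s, I s} ->
    {in st_todo st, forall c, I c};
  inv_treated : {in st_selected st, forall u c, composition lt u c ->
    c \in st_todo st \/ trivial_mod lt [in st_S st] c}
}.

Lemma init_invariant F : invariant F (init lt F).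
Proof.
set S := [fset (lc lt f)^-1 *: f | f in F & f != 0].
have SP s : reflect (exists2 f, (f \in F) && (f != 0) & s = (lc lt f)^-1 *: f)
                    (s \in S).
  by apply: (iffP (imfsetP _ _ _ _)) => -[f]; exists f.
split=> //=; rewrite -/S.
- by move=> s /SP[f /andP[_ nz_f] ->]; apply: monic_normalized.
- move=> s s_S; rewrite in_fsetU; apply/orP; left.
  by apply/imfsetP; exists s.
- move=> s t s_S t_S _; rewrite in_fsetU; apply/orP; right.
  exact: in_imfset2.
- move=> u; rewrite in_fsetU => /orP[/imfsetP[s s_S ->]//|].
  by move=> /imfset2P[s s_S [t t_S ->]].
- move=> I ideal_I; split=> [IF s /SP[f /andP[f_F _] ->]|IS f f_F].
    by apply: (idealZ ideal_I); apply: IF.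
  have [->|nz_f] := eqVneq f 0; first by case: ideal_I.
  rewrite -[f](scalerKV (lc_neq0 lt_monomial nz_f)).
  by apply: (idealZ ideal_I); apply/IS/SP; exists f; rewrite ?f_F.
Qed.

Lemma item_in_sub S S' u : {subset S <= S'} -> item_in S u -> item_in S' u.
Proof. by move=> sub_S; case: u => [s|[s t]] /=; [auto | case; auto]. Qed.

Lemma ideal_composition I S u c : ideal I -> {in S, forall s, I s} ->
  item_in S u -> composition lt u c -> I c.
Proof.
move=> ideal_I IS; case: u => [s|[s t]] /= => [s_S|[s_S t_S]] comp_c.
  exact: (ideal_comp1 ideal_I comp_c (IS s s_S)).
exact: (ideal_comp2 ideal_I comp_c (IS s s_S) (IS t t_S)).
Qed.

Lemma step_invariant F st st' : step lt st st' -> invariant F st -> invariant F st'.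
Proof.
case=> [S G D u cs u_G u_D csP|S G D c cs [red_c _]|S G D c cs r h [red_c _] nz_r]
  [/= monicS singleG pairG itemG idealS todoS treatedD].
- split=> //= [I ideal_I IS c /csP comp_c|v].
    exact: ideal_composition ideal_I IS (itemG u u_G) comp_c.
  rewrite in_fset1U => /predU1P[->|/treatedD trivD] c comp_c; last first.
    by case: (trivD c comp_c); right.
  by left; apply/csP.
- split=> //= [I ideal_I IS d d_cs|u u_D d comp_d].
    by apply: (todoS I ideal_I IS); rewrite inE d_cs orbT.
  case: (treatedD u u_D d comp_d) => [|triv_d]; last by right.
  rewrite inE => /predU1P[->|]; [right | by left].
  apply: (@reduces_trivial_mod _ _ _ lt_monomial _ _ _ _ 0 0) red_c _ _ => //.
    by rewrite scale0r.
  by rewrite eqxx.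
- have nz_h : h != 0 := normalized_neq0 nz_r.
  have sub_S : {subset S <= h |` S} by move=> s s_S; rewrite in_fset1U s_S orbT.
  have def_r : r = lc lt r *: h by rewrite scalerKV // lc_neq0.
  have monic_h : Defs.monic lt h by apply: monic_normalized.
  have ideal_h I : ideal I -> I r -> I h by move=> ideal_I; apply: idealZ.
  (* From here on, only the collected properties of h matter. *)
  clearbody h; split=> /=.
  + by move=> s; rewrite in_fset1U => /predU1P[->|/monicS].
  + move=> s; rewrite in_fset1U !in_fsetU => /predU1P[->|/singleG->//].
    by rewrite in_fset1 eqxx orbT.
  + move=> s t; rewrite ![_ \in h |` S]in_fset1U.
    move=> /predU1P[->|s_S] /predU1P[->|t_S] neq_st.
    * by case: (neq_st erefl).
    * by apply/fsetUP; left; apply/fsetUP; right; apply/imfsetP; exists t.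
    * by apply/fsetUP; right; apply/imfsetP; exists s.
    * by do 3![apply/fsetUP; left]; apply: pairG.
  + have h_S : h \in h |` S by apply: fset1U1.
    move=> u; rewrite !in_fsetU => /orP[/orP[/orP[/itemG|]|]|].
    * exact: item_in_sub.
    * by rewrite in_fset1 => /eqP->.
    * by move=> /imfsetP[s /sub_S s_S ->].
    * by move=> /imfsetP[s /sub_S s_S ->].
  + move=> I ideal_I; rewrite (idealS I ideal_I).
    split=> IS s; last by move=> /sub_S/IS.
    rewrite in_fset1U => /predU1P[->|/IS//]; apply: (ideal_h I ideal_I).
    apply: (ideal_reduces ideal_I (S := [in S])) red_c _ => //.
    by apply: (todoS I ideal_I IS); rewrite mem_head.
  + move=> I ideal_I IS d d_cs; apply: (todoS I ideal_I); last by rewrite inE d_cs orbT.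
    by move=> s /sub_S/IS.
  + move=> u u_D d comp_d; case: (treatedD u u_D d comp_d) => [|triv_d]; last first.
      by right; apply: trivial_mod_sub triv_d.
    rewrite inE => /predU1P[->|]; [right | by left].
    apply: (reduces_trivial_mod lt_monomial sub_S red_c def_r) => _.
    by split; [exact: (fset1U1 h S) | exact: nz_h].
Qed.

Lemma reachable_invariant F st : reachable lt F st -> invariant F st.
Proof.
move=> reach; suff: forall st0, clos_refl_trans _ (step lt) st0 st ->
    invariant F st0 -> invariant F st by apply; [exact: reach | exact: init_invariant].
move=> st0.
elim=> {st0 reach} {}st => [st' /step_invariant|//|st1 st2 _ IH1 _ IH2 /IH1/IH2//].
exact.
Qed.

Lemma comp2_diag f c : ~ comp2 lt f f c.
Proof.
by case=> [/eqP|x m p -> /eqP|x p q _ _ _|u v w a b p q _ _ _ -> [->]].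
Qed.

Lemma invariant_final F st : invariant F st -> final st ->
  groebner_shirshov lt [in st_S st] /\
  (forall f, Id [in st_S st] f <-> Id [in F] f).
Proof.
case: st => S G D todo [/= monicS singleG pairG _ idealS _ treatedD].
case/andP=> /= /fsubsetP sub_GD /eqP todo0; split; last first.
  move=> f; split=> Id_f I ideal_I IS; apply: Id_f => //.
    exact/(idealS I ideal_I).
  exact/(idealS I ideal_I).
have triv u c : u \in G -> composition lt u c -> trivial_mod lt [in S] c.
  by move=> /sub_GD u_D comp_c; case: (treatedD u u_D c comp_c); rewrite ?todo0.
split=> // [f f_S c|f g f_S g_S c].
  exact: triv (singleG f f_S).
have [->/comp2_diag//|/eqP neq_fg] := eqVneq f g.
exact: triv (pairG f g f_S g_S neq_fg).
Qed.

End Algorithm.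

(* Every execution is finite, and so is every computation of a remainder in it;
   an execution never gets stuck before all items have been processed; the set
   returned is a Groebner-Shirshov basis of the ideal generated by F. *)
Theorem lemma30 (k : fieldType) (X : finType) (lt : rel {cmonom X})
    (lt_monomial : monomial_order lt) (F : {fset Di k X}) :
  [/\ Acc (fun st' st => step lt st st') (init lt F),
      forall st, reachable lt F st ->
        well_founded (fun f' f => one_step lt [in st_S st] f f'),
      forall st, reachable lt F st -> ~~ final st -> exists st', step lt st st'
    & forall st, reachable lt F st -> final st ->
        groebner_shirshov lt [in st_S st]
        /\ (forall f, Id [in st_S st] f <-> Id [in F] f)].
Proof.
split=> [|st _|st _|st /(reachable_invariant lt_monomial)].
- exact: step_terminates.
- exact: one_step_wf.
- exact: step_progress.
- exact: invariant_final.
Qed.
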